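(* Let $\mathcal{F}$ be a class of distribution functions on $\mathsf{O}\subseteq\mathbb{R}$ having finite first moments. Let $k\ge 2$, let $q_1,\dots,q_{k-1}\in(0,1)$ be pairwise distinct and $p_1,\dots,p_{k-1}\in(0,1]$ with $\sum_{i=1}^{k-1}p_i=1$. For $F\in\mathcal{F}$ define $T_i(F):=F^{\leftarrow}(q_i)$ for $i=1,\dots,k-1$ and $$T_k(F):=-\sum_{i=1}^{k-1}p_i\,\mathrm{ES}_{q_i}(F).$$ Set $\mathsf{A}:=T_1(\mathcal{F})\times\dots\times T_k(\mathcal{F})\subset\mathbb{R}^k$ and $T:\mathcal{F}\to\mathsf{A}$, $T(F):=(T_1(F),\dots,T_k(F))^\top$. If all members of $\mathcal{F}$ have unique $q_i$-quantiles ($i=1,\dots,k-1$), then $T$ is elicitable. Moreover, an $\mathcal{F}$-consistent scoring function $S:\mathsf{A}\times\mathsf{O}\to\mathbb{R}$ for $T$ is given by $$S(x,y)=-f(x_k)+f'(x_k)\left(x_k+\sum_{i=1}^{k-1}\frac{p_i}{q_i}\big((\mathbf{1}_{\{y\le x_i\}}-q_i)x_i-\mathbf{1}_{\{y\le x_i\}}y\big)\right)+c\sum_{i=1}^{k-1}\frac{p_i}{q_i}\big((\mathbf{1}_{\{y\le x_i\}}-q_i)x_i-\mathbf{1}_{\{y\le x_i\}}y\big),$$ where $c\in\mathbb{R}$ and $f:T_k(\mathcal{F})\to\mathbb{R}$ is convex and differentiable and satisfies $-f'\le c$. If all $q_i$-quantiles are unique and $f$ is strictly convex with $-f'<c$,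 then $S$ is strictly $\mathcal{F}$-consistent for $T$.
   Context: For a univariate distribution function $F$ and $\alpha\in(0,1)$ set $F^{\leftarrow}(\alpha):=\inf\{x\in\mathbb{R}: F(x)\ge\alpha\}$ and $F^{\rightarrow}(\alpha):=\inf\{x\in\mathbb{R}:F(x)>\alpha\}$. Any element of $[F^{\leftarrow}(\alpha),F^{\rightarrow}(\alpha)]$ is an $\alpha$-quantile of $F$; $F$ has a unique $\alpha$-quantile if $F^{\leftarrow}(\alpha)=F^{\rightarrow}(\alpha)$. The Expected Shortfall at level $\alpha\in(0,1)$ of $F$ (with finite first moment) is $\mathrm{ES}_\alpha(F):=-\frac1\alpha\int_0^\alpha F^{\leftarrow}(u)\,\mathrm{d}u$. $\mathsf{O}\subseteq\mathbb{R}$ is equipped with its Borel $\sigma$-algebra and the members of $\mathcal{F}$ are distribution functions of Borel probability measures on $\mathsf{O}$. A scoring function is a function $S:\mathsf{A}\times\mathsf{O}\to\mathbb{R}$ such that $S(x,\cdot)$ is integrable with respect to every $F\in\mathcal{F}$ for every $x\in\mathsf{A}$; put $\bar S(x,F):=\int_{\mathsf{O}}S(x,y)\,\mathrm{d}F(y)$. It is $\mathcal{F}$-consistent for $T:\mathcal{F}\to\mathsf{A}$ if $\bar S(x,F)\ge\bar S(T(F),F)$ for all $x\in\mathsf{A}$, $F\in\mathcal{F}$; it is strictly $\mathcal{F}$-consistent for $T$ if in addition $\bar S(x,F)=\bar S(T(F),F)$ implies $x=T(F)$. $T$ is elicitable if there exists a strictly $\mathcal{F}$-consistent scoring function for $T$.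 *)

(* Defs.v *)
From HB Require Import structures.
From mathcomp Require Import all_boot all_order all_algebra.
From mathcomp Require Import all_classical all_reals all_analysis.

Set Implicit Arguments.
Unset Strict Implicit.
Unset Printing Implicit Defensive.

Import Order.TTheory GRing.Theory Num.Theory.
Import numFieldNormedType.Exports.

Local Open Scope classical_set_scope.
Local Open Scope ring_scope.

(* The subset O of R as a measurable space, for the trace on O of the Borel
   sigma-algebra of R (i.e. the Borel sigma-algebra of the subspace O); O need
   not be Borel.  Nonemptiness is needed because a [measurableType] is pointed;
   there is no probability measure on the empty set. *)
Definition borel_sub (R : realType) (O : set R) (O0 : O !=set0) : Type := O.

Definition sub_val (R : realType) (O : set R) (O0 : O !=set0)
  (y : borel_sub O0) : R := set_val (y : O).

HB.instance Definition _ (R : realType) (O : set R) (O0 : O !=set0) :=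
  Choice.copy (borel_sub O0) (set_type O).

HB.instance Definition _ (R : realType) (O : set R) (O0 : O !=set0) :=
  isPointed.Build (borel_sub O0)
    (exist _ (projT1 (cid O0)) (mem_set (projT2 (cid O0)))).

Section borel_sub_measurable.
Context (R : realType) (O : set R) (O0 : O !=set0).

Let trace : set (set (borel_sub O0)) :=
  preimage_set_system setT (@sub_val R O O0)
    (@measurable _ R).

Let trace_sigma : sigma_algebra setT trace.
Proof. by apply: sigma_algebra_preimage; exact: sigma_algebra_measurable. Qed.

Let trace0 : trace set0.
Proof. by case: trace_sigma. Qed.

Let traceC (A : set (borel_sub O0)) : trace A -> trace (~` A).
Proof. by case: trace_sigma => _ tC _ /tC; rewrite setTD. Qed.

Let traceU (F : (set (borel_sub O0))^nat) :
  (forall i, trace (F i)) -> trace (\bigcup_i F i).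
Proof. by case: trace_sigma => _ _; exact. Qed.

HB.instance Definition _ :=
  @isMeasurable.Build (preimage_display (@sub_val R O O0)) (borel_sub O0)
    trace trace0 traceC traceU.

Lemma measurable_sub_val : measurable_fun setT (@sub_val R O O0).
Proof. by move=> _ A mA; exists A. Qed.

HB.instance Definition _ :=
  isMeasurableFun.Build _ _ (borel_sub O0) R
    (@sub_val R O O0) measurable_sub_val.

End borel_sub_measurable.

(* A Borel probability measure on O is identified with its distribution
   function, which is recovered as follows. *)
Definition distribution_function (R : realType) (O : set R) (O0 : O !=set0)
    (P : probability (borel_sub O0) R) (x : R) : R :=
  fine (cdf (@sub_val R O O0 : {RV P >-> R}) x).

Definition left_quantile (R : realType) (F : R -> R) (a : R) : R :=
  inf [set x | a <= F x].

Definition right_quantile (R : realType) (F : R -> R) (a : R) : R :=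
  inf [set x | a < F x].

Definition unique_quantile (R : realType) (F : R -> R) (a : R) : Prop :=
  left_quantile F a = right_quantile F a.

Definition expected_shortfall (R : realType) (a : R) (F : R -> R) : R :=
  - (a^-1 * \int[lebesgue_measure]_(u in `]0, a[) left_quantile F u).

Definition finite_first_moment (R : realType) (O : set R) (O0 : O !=set0)
    (P : probability (borel_sub O0) R) : Prop :=
  P.-integrable setT (EFin \o @sub_val R O O0).

(* Only the values of S on A x Y and of T on FF matter. *)
Definition scoring_function d (Y : measurableType d) (R : realType) (X : Type)
    (A : set X) (FF : set (probability Y R)) (S : X -> Y -> R) : Prop :=
  forall x, A x -> forall P, FF P -> P.-integrable setT (EFin \o S x).

Definition expected_score d (Y : measurableType d) (R : realType) (X : Type)
    (S : X -> Y -> R) (x : X) (P : probability Y R) : R :=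
  \int[P]_y S x y.

Definition consistent d (Y : measurableType d) (R : realType) (X : Type)
    (A : set X) (FF : set (probability Y R)) (T : probability Y R -> X)
    (S : X -> Y -> R) : Prop :=
  scoring_function A FF S /\
  forall x P, A x -> FF P -> expected_score S (T P) P <= expected_score S x P.

Definition strictly_consistent d (Y : measurableType d) (R : realType)
    (X : Type) (A : set X) (FF : set (probability Y R))
    (T : probability Y R -> X) (S : X -> Y -> R) : Prop :=
  consistent A FF T S /\
  forall x P, A x -> FF P ->
    expected_score S x P = expected_score S (T P) P -> x = T P.

Definition elicitable d (Y : measurableType d) (R : realType) (X : Type)
    (A : set X) (FF : set (probability Y R)) (T : probability Y R -> X) : Prop :=
  exists S : X -> Y -> R, strictly_consistent A FF T S.

(* Here k = n + 1: the indices 1, ..., k-1 are [lift ord_max i] for i : 'I_n,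
   and the index k is [ord_max]. *)
Definition neg_spectral_risk (R : realType) (O : set R) (O0 : O !=set0) (n : nat)
    (q p : 'I_n -> R) (P : probability (borel_sub O0) R) : R :=
  - \sum_(i < n) p i * expected_shortfall (q i) (distribution_function P).

Definition quantiles_and_neg_risk (R : realType) (O : set R) (O0 : O !=set0)
    (n : nat) (q p : 'I_n -> R) (P : probability (borel_sub O0) R) :
    'rV[R]_n.+1 :=
  \row_(j < n.+1)
    if unlift ord_max j is Some i
    then left_quantile (distribution_function P) (q i)
    else neg_spectral_risk q p P.

(* T_1(FF) x ... x T_m(FF), for T = (T_1, ..., T_m). *)
Definition image_product (U : Type) (R : realType) (m : nat) (FF : set U)
    (T : U -> 'rV[R]_m) : set 'rV[R]_m :=
  [set x | forall j, ((fun P => T P ord0 j) @` FF) (x ord0 j)].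

Definition quantile_score (R : realType) (n : nat) (q p : 'I_n -> R)
    (x : 'rV[R]_n.+1) (y : R) : R :=
  \sum_(i < n) p i / q i *
    (let xi := x ord0 (lift ord_max i) in
     ((y <= xi)%R%:R - q i) * xi - (y <= xi)%R%:R * y).

Definition spectral_score (R : realType) (n : nat) (q p : 'I_n -> R) (c : R)
    (f f' : R -> R) (x : 'rV[R]_n.+1) (y : R) : R :=
  let xk := x ord0 ord_max in
  - f xk + f' xk * (xk + quantile_score q p x y) + c * quantile_score q p x y.

Definition strictly_convex_function (R : realType) (D : set R) (f : R -> R) :
    Prop :=
  forall t : {i01 R}, 0 < t%:num < 1 ->
    {in D &, forall x y : R, x != y ->
      f (t%:num * x + (1 - t%:num) * y)
        < t%:num * f x + (1 - t%:num) * f y}.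

(* f' is the derivative of f at x relative to D: one-sided at an endpoint of
   an interval D, and unconstrained if D is reduced to x. *)
Definition is_derive_within (R : realType) (D : set R) (f : R -> R) (x l : R) :
    Prop :=
  (f z - f x) / (z - x) @[z --> within D x^'] --> l.

(* Main.v *)
From HB Require Import structures.
Require Import Defs.
From mathcomp Require Import all_boot all_order all_algebra.
From mathcomp Require Import all_classical all_reals all_analysis.
From mathcomp Require Import measurable_realfun ring lra.
Import Order.TTheory GRing.Theory Num.Theory.
Import numFieldNormedType.Exports.

Set Implicit Arguments.
Unset Strict Implicit.
Unset Printing Implicit Defensive.

Local Open Scope classical_set_scope.
Local Open Scope ring_scope.

(* The quantile function Q of F pushes Lebesgue measure on ]0, 1[ forward to the
   law of Y, so that E (x - Y)^+ is the integral of (x - Q u)^+ over ]0, 1[.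
   Restricting to ]0, r[ gives E (x - Y)^+ >= r x - I(r), where I(r) is the
   integral of Q over ]0, r[, with equality at x = Q(r).  Hence
   E (x - Y)^+ - q x is minimal at x = Q(q), with minimum - I(q) = q ES_q(F).
   If equality holds at level q for some x, comparing with the inequality at
   neighbouring levels r confines x to [Q(q), Q^->(q)].
   Weighting by p_i / q_i and summing, the mean of the quantile part of S is at
   least - T_k(F), with equality at T(F).  As f' + c >= 0, the mean score at x
   is at least - f(x_k) + f'(x_k) (x_k - T_k(F)) - c T_k(F), and the tangent
   inequality of the convex f bounds this below by - f(T_k(F)) - c T_k(F), the
   mean score at T(F).  Elicitability follows with f = exp and c = 0. *)

(** * Finite measures on the line are determined by upper rays *)

Section measure_rays.
Context {R : realType}.
Variables mu nu : {finite_measure set R -> \bar R}.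

(** Upper rays are stable under intersection, generate the Borel sets, and the rays starting at
    [- n%:R] exhaust the line with finite measure. *)
Lemma eq_measure_rays :
  (forall r : R, mu `]r, +oo[%classic = nu `]r, +oo[%classic) ->
  forall A, measurable A -> mu A = nu A.
Proof.
move=> munu A mA.
apply: (@g_sigma_algebra_measure_unique _ R R (@RGenOInfty.G R) _
  (fun n => `](- n%:R)%R, +oo[%classic) _ _ mu nu) => //.
- by move=> _ [x ->]; exact: measurable_itv.
- by move=> n; exists (- n%:R).
- apply/seteqP; split => // x _; exists (Num.truncn `|x|).+1 => //=.
  rewrite in_itv/= andbT ltrNl (le_lt_trans _ (truncnS_gt _))//.
  by rewrite -normrN ler_norm.
- move=> _ _ [x ->] [y ->]; exists (Num.max x y).
  apply/seteqP; split => [z [/=]|z /=]; rewrite !in_itv/= !andbT gt_max.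
    by move=> -> ->.
  by move=> /andP.
- by move=> _ [x ->]; exact: munu.
- by move=> n; rewrite -ge0_fin_numE// fin_num_measure.
- rewrite -[_ A]/((@RGenOInfty.G R).-sigma.-measurable A).
  by rewrite -RGenOInfty.measurableE.
Qed.

End measure_rays.

Lemma integral_uniform01 (R : realType) (f : R -> \bar R) :
  measurable_fun [set: R] f -> (forall x, 0 <= f x)%E ->
  (\int[uniform_prob (@ltr01 R)]_x f x =
   \int[lebesgue_measure]_(x in `]0%R, 1%R[) f x)%E.
Proof.
move=> mf f0; rewrite integral_uniform// subr0 invr1 mul1e.
rewrite -integral_itv_obnd_cbnd -?integral_itv_bndo_bndc//;
  exact: measurable_funTS.
Qed.

Lemma normr_maxr0_le (R : realDomainType) (x : R) : `|Num.max x 0| <= `|x|.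
Proof. by case: (leP 0 x) => // _; rewrite normr0. Qed.

(** * The quantile function and its law under Lebesgue measure *)

(** For the inclusion of O this is convertible to [distribution_function], so that the results on a
    general random variable apply there directly. *)
Definition fine_cdf d (T : measurableType d) (R : realType)
    (P : probability T R) (X : {RV P >-> R}) (x : R) : R :=
  fine (cdf X x).

Definition lower_partial_moment d (T : measurableType d) (R : realType)
    (P : probability T R) (X : {RV P >-> R}) (x : R) : R :=
  \int[P]_t Num.max (x - X t) 0.

(** For [r] in []0, 1[] this is [- r] times the expected shortfall at level [r]; as a function of
    [r] it is the convex conjugate of the lower partial moment. *)
Definition integrated_quantile (R : realType) (F : R -> R) (r : R) : R :=
  \int[lebesgue_measure]_(u in `]0, r[) left_quantile F u.

Section quantile.
Context d (T : measurableType d) (R : realType) (P : probability T R).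
Variable X : {RV P >-> R}.

Local Notation F := (fine_cdf X).
Local Notation Q := (left_quantile F).
Local Notation I := (integrated_quantile F).
Local Notation h := (lower_partial_moment X).

Let cdfE x : cdf X x = (F x)%:E.
Proof. by rewrite /fine_cdf fineK// fin_num_measure. Qed.

Lemma fine_cdf_nondecreasing : {homo F : x y / x <= y}.
Proof. by move=> x y xy; rewrite -lee_fin -!cdfE cdf_nondecreasing. Qed.

Lemma fine_cdf_itv01 x : 0 <= F x <= 1.
Proof. by rewrite -!lee_fin -cdfE cdf_ge0 cdf_le1. Qed.

Lemma fine_cdf_right_continuous : right_continuous F.
Proof.
by move=> a; apply: fine_cvg; rewrite -cdfE; exact: cdf_right_continuous.
Qed.

(** Together with [le_fine_cdf_has_lbound], this makes the infimum in [Q u] a genuine one for [u] in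
    []0, 1[]. *)
Lemma le_fine_cdf_nonempty u : u < 1 -> [set x | u <= F x] !=set0.
Proof.
move=> u1; have /fine_cvg F1 := cvg_cdfy1 X.
have [M [_ /(_ (M + 1))]] := cvgr_ge _ F1 _ u1; rewrite ltrDl => /(_ ltr01) uM.
by exists (M + 1).
Qed.

Lemma le_fine_cdf_has_lbound u : 0 < u -> has_lbound [set x | u <= F x].
Proof.
move=> u0; have /fine_cvg F0 := cvg_cdfNy0 X.
have [M [_ MF]] := cvgr_lt _ F0 _ u0.
exists (M - 1) => x /= ux; rewrite leNgt; apply/negP => xM.
by have := MF x (lt_trans xM _); rewrite gtrBl => /(_ ltr01); rewrite ltNge ux.
Qed.

(** Galois connection between [Q] and [F]: right-continuity of [F] makes the infimum defining [Q u]
    attained. *)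
Lemma left_quantile_le u t : 0 < u < 1 -> (Q u <= t) = (u <= F t).
Proof.
move=> /andP[u0 u1]; have A0 := le_fine_cdf_nonempty u1.
have lbA := le_fine_cdf_has_lbound u0.
apply/idP/idP => [Qt|ut]; last exact: ge_inf.
apply: le_trans (fine_cdf_nondecreasing Qt).
have /cvgrPdist_lt FQ := @fine_cdf_right_continuous (Q u).
(* If [F (Q u) < u], then [F] stays below [u] just to the right of [Q u], although the infimum
   provides points [y] there with [u <= F y]. *)
rewrite leNgt; apply/negP => FQu.
have := FQ (u - F (Q u)); rewrite subr_gt0 => /(_ FQu) [e /= e0 eF].
have [|y /= uy yQ] := @inf_lt _ [set x | u <= F x] (Q u + e) A0.
  by rewrite ltrDl.
have Qy : Q u <= y by exact: ge_inf.
have := Qy; rewrite le_eqVlt => /predU1P[Qy'|Qy'].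
  by move: uy; rewrite -Qy' leNgt FQu.
have := eF y; rewrite /ball_/= -normrN opprB ger0_norm ?subr_ge0// ltrBlDl.
move=> /(_ yQ Qy'); rewrite -normrN opprB => /ltr_normlW.
by rewrite ltrBrDl addrC addrNK ltNge uy.
Qed.

Lemma left_quantile_nondecreasing u v : 0 < u -> u <= v -> v < 1 -> Q u <= Q v.
Proof.
move=> u0 uv v1; rewrite left_quantile_le ?u0 ?(le_lt_trans uv)//.
by rewrite (le_trans uv)// -left_quantile_le// (lt_le_trans u0).
Qed.

(** The Galois connection, negated. It yields both the measurability of [Q] and its law. *)
Let preimage_ray x : `]0, 1[ `&` Q @^-1` `]x, +oo[ = `]F x, 1[%classic.
Proof.
have /andP[F0 F1] := fine_cdf_itv01 x.
apply/seteqP; split => [u [/=]|u /=].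
  rewrite !in_itv/= andbT => u01.
  rewrite ltNge left_quantile_le// -ltNge => ->.
  by case/andP : u01.
rewrite !in_itv/= andbT => /andP[Fu u1].
have u01 : 0 < u < 1 by rewrite u1 (le_lt_trans F0).
by rewrite u01 ltNge left_quantile_le// -ltNge.
Qed.

Lemma measurable_left_quantile : measurable_fun (`]0, 1[%classic : set R) Q.
Proof.
move=> mD; apply: (measurability _ (RGenOInfty.measurableE R)) => //.
by move=> _ [_ [x ->] <-]; rewrite preimage_ray; exact: measurable_itv.
Qed.

Let Q01 : R -> R := Q \_ `]0, 1[.

Let measurable_Q01 : measurable_fun [set: R] Q01.
Proof.
by apply/(measurable_restrictT _ _).1 => //; exact: measurable_left_quantile.
Qed.

(* [uniform_prob] is a measure on [measurableTypeR R], whose display differs from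
   that of [R]. *)
Let quantile_rv : {mfun measurableTypeR R >-> R} :=
  HB.pack Q01
    (@isMeasurableFun.Build _ _ (measurableTypeR R) R Q01 measurable_Q01).

(** The law of [X] and that of [Q] under the uniform law both give the ray above [r] the mass
    [1 - F r], hence coincide. *)
Lemma ge0_integral_left_quantile (g : R -> \bar R) :
  measurable_fun [set: R] g -> (forall x, 0 <= g x)%E ->
  (\int[P]_t g (X t) = \int[lebesgue_measure]_(u in `]0%R, 1%R[) g (Q u))%E.
Proof.
move=> mg g0; rewrite -(ge0_integral_distribution X mg g0).
have law A : measurable A ->
    distribution P X A = distribution (uniform_prob (@ltr01 R)) quantile_rv A.
  apply: eq_measure_rays => r.
  have mr : measurable (`]r, +oo[%classic : set R) by exact: measurable_itv.
  transitivity (1 - F r)%:E.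
    rewrite -setCitvl; etransitivity.
      exact: (probability_setC (distribution P X) (measurable_itv `]-oo, r])).
    by rewrite EFinB -cdfE.
  have /andP[F0 F1] := fine_cdf_itv01 r.
  (* The mass of the ray is written as the integral of its indicator, so that it can be moved to
     Lebesgue measure on []0, 1[]. *)
  have mi : measurable_fun [set: R]
      (EFin \o (\1_(`]r, +oo[%classic : set R) : R -> R)).
    by apply: measurableT_comp => //; exact: measurable_indic.
  rewrite -[`]r, +oo[%classic]setIT -integral_indic//.
  rewrite (ge0_integral_distribution quantile_rv mi)//=.
  rewrite (integral_uniform01 (measurableT_comp mi measurable_Q01))//=.
  transitivity (\int[lebesgue_measure]_(u in `]0%R, 1%R[)
      (\1_(`]F r, 1[%classic : set R) u)%:E)%E; last first.
    apply: eq_integral => u u01; rewrite -preimage_ray /Q01 !indicE patchE u01.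
    by rewrite in_setI u01.
  rewrite integral_indic//= setIidl; last first.
    by apply: subset_itvr; rewrite bnd_simp.
  rewrite lebesgue_measure_itv/= lte_fin; case: ltP => // F1'.
  by have -> : F r = 1 by [apply/le_anti; rewrite F1 F1']; rewrite subrr.
rewrite (eq_measure_integral
  (distribution (uniform_prob (@ltr01 R)) quantile_rv)).
  rewrite ge0_integral_distribution// integral_uniform01//.
  - by apply: eq_integral => u /= u01; rewrite /Q01 patchE u01.
  - exact: measurableT_comp.
  - by move=> u; exact: g0.
by move=> A mA _; exact: law.
Qed.

(** * Lower partial moments and the minimisers of the quantile score *)

Hypothesis iX : P.-integrable setT (EFin \o X).

Local Notation mu := (@lebesgue_measure R).

Lemma integrable_left_quantile :
  mu.-integrable `]0, 1[ (EFin \o Q).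
Proof.
apply/integrableP; split.
  by apply/measurable_EFinP; exact: measurable_left_quantile.
have mabs : measurable_fun [set: R] (fun x : R => `|x|%:E).
  by apply: measurableT_comp => //; exact: normr_measurable.
have := ge0_integral_left_quantile mabs (fun x => normr_ge0 x).
move=> /= <-; by case/integrableP : iX.
Qed.

Let sub01 a b : 0 <= a -> b <= 1 -> `]a, b[ `<=` (`]0, 1[%classic : set R).
Proof. by move=> a0 b1; apply: subset_itv; rewrite bnd_simp. Qed.

Let integrableQ a b : 0 <= a -> b <= 1 ->
  mu.-integrable `]a, b[ (EFin \o Q).
Proof.
move=> a0 b1; apply: integrableS integrable_left_quantile => //.
exact: sub01.
Qed.

Let integrable_cst (a b r : R) : mu.-integrable `]a, b[ (EFin \o cst r).
Proof.
apply: measurable_bounded_integrable => //.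
  rewrite [ltLHS]lebesgue_measure_itv/=; case: ifPn => // _.
  by rewrite -EFinB ltry.
exact: bounded_cst.
Qed.

Let Rintegral_itv_cst (a b r : R) : a <= b ->
  \int[mu]_(u in `]a, b[) r = r * (b - a).
Proof.
move=> ab; rewrite Rintegral_cst//.
rewrite [X in fine X]lebesgue_measure_itv/= lte_fin.
by case: ltgtP ab => // ->; rewrite subrr.
Qed.

Let integrated_quantileB (r s : R) : 0 <= r -> r < s -> s <= 1 ->
  I s - I r = \int[mu]_(u in `]r, s[) Q u.
Proof.
move=> r0 rs s1; rewrite /integrated_quantile.
rewrite (@Rintegral_itv_bndo_bndc _ _ r); last first.
  by apply: integrableQ => //; exact: le_trans (ltW rs) s1.
by rewrite Rintegral_itvB ?bnd_simp//; exact: integrableQ.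
Qed.

Lemma integrable_lower_partial_moment (x : R) :
  P.-integrable setT (fun t => (Num.max (x - X t) 0)%:E).
Proof.
have iXx : P.-integrable setT (fun t => (x - X t)%:E).
  under eq_fun do rewrite EFinB.
  apply: integrableB => //.
  exact: (finite_measure_integrable_cst _ x).
apply: le_integrable iXx => //.
  apply/measurable_EFinP; apply: measurable_maxr => //.
  exact: measurable_funB.
move=> t _; rewrite /= lee_fin.
exact: normr_maxr0_le.
Qed.

Let lower_partial_momentE x :
  h x = \int[mu]_(u in `]0, 1[) Num.max (x - Q u) 0.
Proof.
rewrite /lower_partial_moment /Rintegral.
have mg : measurable_fun [set: R] (fun y : R => (Num.max (x - y) 0)%:E).
  apply/measurable_EFinP; apply: measurable_maxr => //.
  exact: measurable_funB.
have g0 (y : R) : (0 <= (Num.max (x - y) 0)%:E)%E.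
  by rewrite lee_fin le_max lexx orbT.
by rewrite (ge0_integral_left_quantile mg g0).
Qed.

Let integrable_maxQ (x : R) :
  mu.-integrable `]0, 1[ (EFin \o (fun u => Num.max (x - Q u) 0)).
Proof.
have ixQ : mu.-integrable `]0, 1[ (fun u => x%:E - (Q u)%:E)%E.
  by apply: integrableB => //; [exact: integrable_cst|exact: integrableQ].
apply: le_integrable ixQ => //.
  apply/measurable_EFinP; apply: measurable_maxr => //.
  by apply: measurable_funB => //; exact: measurable_left_quantile.
move=> u _; rewrite /= lee_fin.
exact: normr_maxr0_le.
Qed.

Let Rintegral_subQ (x r : R) : 0 < r < 1 ->
  \int[mu]_(u in `]0, r[) (x - Q u) = r * x - I r.
Proof.
move=> /andP[r0 r1]; rewrite (RintegralB (f1 := cst x))//; last first.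
  by apply: integrableQ => //; exact: ltW.
by rewrite Rintegral_itv_cst ?(ltW r0)// subr0 mulrC.
Qed.

(** A Young inequality: on []0, r[] the difference [x - Q u] is below its positive part, and
    enlarging the domain to []0, 1[] only adds nonnegative mass. *)
Lemma le_lower_partial_moment (x r : R) : 0 < r < 1 -> r * x - I r <= h x.
Proof.
move=> r01; have /andP[r0 r1] := r01.
rewrite -Rintegral_subQ// lower_partial_momentE.
have r_sub : `]0, r[ `<=` (`]0, 1[%classic : set R).
  by apply: sub01 => //; exact: ltW.
have iM : mu.-integrable `]0, r[ (EFin \o (fun u => Num.max (x - Q u) 0)).
  exact: integrableS (integrable_maxQ x).
have ixQ : mu.-integrable `]0, r[ (fun u => x%:E - (Q u)%:E)%E.
  apply: integrableB => //; first exact: integrable_cst.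
  by apply: integrableQ => //; exact: ltW.
apply: (@le_trans _ _ (\int[mu]_(u in `]0, r[) Num.max (x - Q u) 0)).
  by apply: le_Rintegral => // u _; rewrite le_max lexx.
rewrite /Rintegral; apply: fine_le.
- by apply: integrable_fin_num => //; exact: iM.
- by apply: integrable_fin_num => //; exact: integrable_maxQ.
apply: ge0_subset_integral => //.
  by case/integrableP : (integrable_maxQ x).
by move=> u _; rewrite lee_fin le_max lexx orbT.
Qed.

(** As [Q] is nondecreasing, [Q r - Q u] changes sign at [u = r], so its positive part is its
    restriction to []0, r[]. *)
Lemma lower_partial_moment_left_quantile (r : R) : 0 < r < 1 ->
  h (Q r) = r * Q r - I r.
Proof.
move=> r01; have /andP[r0 r1] := r01.
rewrite -Rintegral_subQ// lower_partial_momentE.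
have r_sub : `]0, r[ `<=` (`]0, 1[%classic : set R).
  by apply: sub01 => //; exact: ltW.
(* Both integrals are brought to []0, 1[] to compare the integrands pointwise. *)
rewrite -{1}(setIidr r_sub) Rintegral_mkcondr; apply: eq_Rintegral => u.
rewrite inE/= in_itv/= patchE => /andP[u0 u1]; case: ifPn.
  rewrite inE/= in_itv/= => /andP[_ ur].
  by rewrite max_l// subr_ge0 left_quantile_nondecreasing// ltW.
rewrite notin_setE/= in_itv/= u0/= => /negP; rewrite -leNgt => ru.
by rewrite max_r// subr_le0 left_quantile_nondecreasing.
Qed.

(** Equality at [q] and the Young inequality at [r < q] give [I q - I r <= (q - r) * x]. If
    [x < Q q], some [r] makes [Q] exceed a constant [y > x] on []r, q[], a contradiction. *)
Lemma left_quantile_le_argmin (q x : R) : 0 < q < 1 ->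
  h x = q * x - I q -> Q q <= x.
Proof.
move=> q01 hx; have /andP[q0 q1] := q01; rewrite leNgt; apply/negP => xQ.
(* Since [y < Q q], also [F y < q]; any level above [r] exceeds [F y] and so has its quantile above
   [y]. *)
pose y := (x + Q q) / 2; pose r := (F y + q) / 2.
have xy : x < y by rewrite /y; lra.
have Fyq : F y < q by rewrite ltNge -left_quantile_le// -ltNge /y; lra.
have /andP[Fy0 _] := fine_cdf_itv01 y.
have [r0 rq Fyr] : [/\ 0 < r, r < q & F y < r] by split; rewrite /r; lra.
have r1 : r < 1 by exact: lt_trans q1.
have hr : r * x - I r <= h x by apply: le_lower_partial_moment; rewrite r0.
have : (q - r) * y <= I q - I r.
  rewrite integrated_quantileB ?(ltW r0) ?(ltW q1)//.
  have iQ : mu.-integrable `]r, q[ (EFin \o Q).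
    by apply: integrableQ; exact: ltW.
  have ic := integrable_cst r q y.
  rewrite mulrC -Rintegral_itv_cst ?(ltW rq)//; apply: le_Rintegral => // u /=.
  rewrite in_itv/= => /andP[ru uq].
  have u01 : 0 < u < 1 by rewrite (lt_trans r0 ru) (lt_trans uq q1).
  by rewrite ltW// ltNge left_quantile_le// -ltNge (lt_trans Fyr).
nra.
Qed.

(** Mirror argument with [r > q]: now [(r - q) * x <= I r - I q], while some [y < x] with [q < F y]
    bounds [Q] from above at levels below [F y]. *)
Lemma le_right_quantile_argmin (q x : R) : 0 < q < 1 ->
  h x = q * x - I q -> x <= right_quantile F q.
Proof.
move=> q01 hx; have /andP[q0 q1] := q01; rewrite leNgt; apply/negP => Qx.
have [|y /= qFy yx] := @inf_lt _ [set y | q < F y] x _ Qx.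
  (* A level strictly between [q] and 1 turns the large inequality of the lemma into the strict
     one. *)
  have [|y /= qy] := @le_fine_cdf_nonempty ((q + 1) / 2); first lra.
  by exists y => /=; apply: lt_le_trans qy; lra.
have /andP[_ Fy1] := fine_cdf_itv01 y.
pose r := (q + F y) / 2.
have [qr r1 rF] : [/\ q < r, r < 1 & r < F y] by split; rewrite /r; lra.
have r0 : 0 < r by exact: lt_trans qr.
have hr : r * x - I r <= h x by apply: le_lower_partial_moment; rewrite r0.
have : I r - I q <= (r - q) * y.
  rewrite integrated_quantileB ?(ltW q0) ?(ltW r1)//.
  have iQ : mu.-integrable `]q, r[ (EFin \o Q).
    by apply: integrableQ; exact: ltW.
  have ic := integrable_cst q r y.
  rewrite mulrC -Rintegral_itv_cst ?(ltW qr)//; apply: le_Rintegral => // u /=.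
  rewrite in_itv/= => /andP[qu ur].
  have u01 : 0 < u < 1 by rewrite (lt_trans q0 qu) (lt_trans ur r1).
  by rewrite left_quantile_le// ltW// (lt_trans ur).
nra.
Qed.

End quantile.

(** * Tangent inequalities for convex functions on an interval *)

Section subgradient.
Context {R : realType}.
Implicit Types (i : interval R) (f : R -> R) (x z l : R).

(** Convexity bounds the increment from [x] to [x + t * (z - x)] by [t * (f z - f x)]; dividing by
    [t] and letting it tend to 0 gives the tangent. The proof does this by contradiction, with one
    small [t]. *)
Lemma convex_tangent_le i f x z l :
  convex_function (E := R^o) [set` i] f -> x \in i -> z \in i ->
  is_derive_within [set` i] f x l -> f x + l * (z - x) <= f z.
Proof.
move=> cf xi zi /cvgrPdist_lt dfx; rewrite leNgt; apply/negP => lt_fz.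
have zx : z - x != 0.
  apply: contraTneq lt_fz => /subr0_eq ->.
  by rewrite subrr mulr0 addr0 ltxx.
have nzx : 0 < `|z - x| by rewrite normr_gt0.
(* The gap by which the tangent inequality is assumed to fail; the difference quotient is then taken
   within [s / |z - x|] of [l]. *)
pose s := l * (z - x) - (f z - f x).
have s0 : 0 < s by rewrite /s; lra.
have [d /= d0 xd] := dfx _ (divr_gt0 s0 nzx).
(* This keeps [w] between [x] and [z], hence in [i], and at distance at most [d / 2] from [x]. *)
pose t := Num.min 1 (d / 2 / `|z - x|).
have t0 : 0 < t by rewrite lt_min ltr01 divr_gt0 ?divr_gt0.
have t1 : t <= 1 by rewrite ge_min lexx.
pose w := x + t * (z - x).
have wE : w = t * z + (1 - t) * x by rewrite /w; lra.
have fw : f w <= t * f z + (1 - t) * f x.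
  have C := cf (Itv01 (ltW t0) t1) z x (mem_set zi) (mem_set xi).
  by rewrite [X in _ <= X]convRE [X in f X <= _]convRE in C; rewrite wE.
have wx : w - x = t * (z - x) by rewrite /w addrC addKr.
have wi : w \in i.
  have [xz|zx'] := leP x z.
    by apply: (@interval_is_interval _ i _ _ xi zi); rewrite /w; nra.
  by apply: (@interval_is_interval _ i _ _ zi xi); rewrite /w; nra.
have wd : `|x - w| < d.
  rewrite distrC wx normrM (gtr0_norm t0).
  rewrite (@le_lt_trans _ _ (d / 2))//; last by lra.
  by rewrite -(ler_pdivlMr _ _ nzx) ge_min lexx orbT.
have tzx0 : t * (z - x) != 0 by rewrite mulf_neq0// gt_eqF.
have wnx : w != x by rewrite -subr_eq0 wx.
have := xd w wd wnx wi; rewrite wx.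
set v := (f w - f x) / _; rewrite -(ltr_pM2r nzx).
rewrite divfK ?(lt0r_neq0 nzx)// -normrM.
move=> /(le_lt_trans (ler_norm _)); apply/negP; rewrite -leNgt.
have vE : t * ((z - x) * v) = f w - f x.
  by rewrite mulrA [LHS]mulrC divfK.
have : (z - x) * v <= f z - f x by rewrite -(ler_pM2l t0) vE; lra.
by rewrite /s; lra.
Qed.

(** The tangent at [x] lies weakly below [f] at the midpoint, where [f] is strictly below the
    chord. *)
Lemma strictly_convex_tangent_lt i f x z l :
  convex_function (E := R^o) [set` i] f ->
  strictly_convex_function [set` i] f -> x \in i -> z \in i -> x != z ->
  is_derive_within [set` i] f x l -> f x + l * (z - x) < f z.
Proof.
move=> cf scf xi zi xz dfx.
have h0 : 0 <= 2^-1 :> R by lra.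
have h1 : 2^-1 <= 1 :> R by lra.
have h01 : 0 < (Itv01 h0 h1)%:num < 1 by rewrite /=; lra.
have := scf _ h01 z x (mem_set zi) (mem_set xi).
rewrite /= eq_sym xz => /(_ isT); set m := (X in f X) => fm.
have mE : m = (x + z) / 2 by rewrite /m; lra.
have mi : m \in i.
  have [xz'|zx'] := leP x z.
    by apply: (@interval_is_interval _ i _ _ xi zi); rewrite mE; lra.
  by apply: (@interval_is_interval _ i _ _ zi xi); rewrite mE; lra.
have := convex_tangent_le cf xi mi dfx.
by rewrite mE in fm *; lra.
Qed.

End subgradient.

(** * The mean score under a single law *)

Lemma Rintegral_sum d (T : measurableType d) (R : realType)
    (mu : {measure set T -> \bar R}) (D : set T) (I : Type) (s : seq I)
    (f : I -> T -> R) : measurable D ->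
  (forall k, mu.-integrable D (EFin \o f k)) ->
  \int[mu]_(x in D) (\sum_(k <- s) f k x) =
  \sum_(k <- s) \int[mu]_(x in D) f k x.
Proof.
move=> mD intf; rewrite /Rintegral sum_fine.
  congr fine; under eq_integral do rewrite -sumEFin.
  exact: (integral_sum mD intf).
by move=> k _; exact: (integrable_fin_num mD (intf k)).
Qed.

(** This is the pinball loss at level [q] minus [q * y]; the right-hand form brings out the lower
    partial moment. *)
Lemma pinballE (R : realType) (q x y : R) :
  ((y <= x)%R%:R - q) * x - (y <= x)%R%:R * y = Num.max (x - y) 0 - q * x.
Proof.
case: leP => xy /=.
- by rewrite max_l ?subr_ge0//; lra.
- by rewrite max_r ?subr_le0 ?ltW//; lra.
Qed.

Section spectral.
Context {R : realType} {O : set R} {O0 : O !=set0} {n : nat}.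
Variables q p : 'I_n -> R.
Hypotheses (q01 : forall i, 0 < q i < 1) (p01 : forall i, 0 < p i <= 1).
Variable P : probability (borel_sub O0) R.
Hypothesis mP : finite_first_moment P.

Let Y : {RV P >-> R} := @sub_val R O O0.
Local Notation F := (distribution_function P).
Local Notation T := (quantiles_and_neg_risk q p).
Local Notation Tk := (neg_spectral_risk q p).

Local Notation w i := (p i / q i).

Let weight_gt0 i : 0 < w i.
Proof.
by have /andP[p0 _] := p01 i; have /andP[q0 _] := q01 i; rewrite divr_gt0.
Qed.

Local Notation pinball i x := (lower_partial_moment Y x - q i * x).

(** The mean of [quantile_score] under [P], by [Rintegral_quantile_score], in a closed form suited
    to termwise minimisation. *)
Definition mean_quantile_score (x : 'rV[R]_n.+1) : R :=
  \sum_(i < n) w i * pinball i (x ord0 (lift ord_max i)).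

Let le_pinball i x : - integrated_quantile F (q i) <= pinball i x.
Proof.
by have := le_lower_partial_moment (X := Y) mP x (q01 i); lra.
Qed.

Let pinball_left_quantile i :
  pinball i (left_quantile F (q i)) = - integrated_quantile F (q i).
Proof.
have := lower_partial_moment_left_quantile (X := Y) mP (q01 i).
by move=> ->; lra.
Qed.

Lemma neg_spectral_riskE :
  Tk P = \sum_(i < n) w i * integrated_quantile F (q i).
Proof.
rewrite /neg_spectral_risk -sumrN; apply: eq_bigr => i _.
by rewrite /expected_shortfall mulrN opprK mulrA.
Qed.

Lemma le_mean_quantile_score x : - Tk P <= mean_quantile_score x.
Proof.
rewrite neg_spectral_riskE -sumrN; apply: ler_sum => i _.
by rewrite -mulrN ler_pM2l.
Qed.

Lemma quantiles_and_neg_risk_lift i :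
  T P ord0 (lift ord_max i) = left_quantile F (q i).
Proof. by rewrite mxE liftK. Qed.

Lemma quantiles_and_neg_risk_max : T P ord0 ord_max = Tk P.
Proof. by rewrite mxE unlift_none. Qed.

Lemma mean_quantile_score_quantiles : mean_quantile_score (T P) = - Tk P.
Proof.
rewrite neg_spectral_riskE -sumrN; apply: eq_bigr => i _.
by rewrite quantiles_and_neg_risk_lift pinball_left_quantile mulrN.
Qed.

(** With positive weights, the sum reaches its lower bound only if every term does; each [xi] then
    lies between the left and right quantiles, which agree. *)
Lemma mean_quantile_score_min_unique x :
  (forall i, unique_quantile F (q i)) -> mean_quantile_score x = - Tk P ->
  forall i, x ord0 (lift ord_max i) = left_quantile F (q i).
Proof.
move=> uq xmin i; set xi := x _ _.
have pinball_min : pinball i xi = - integrated_quantile F (q i).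
  move: xmin; rewrite neg_spectral_riskE -sumrN => /eqP.
  (* The excess over the bound is a vanishing sum of nonnegative terms. *)
  rewrite eq_sym -subr_eq0 -opprB oppr_eq0 -sumrB psumr_eq0.
    move=> /allP /(_ i (mem_index_enum _)) /=.
    by rewrite opprK -mulrDr mulf_eq0 gt_eqF//= addr_eq0 => /eqP.
  move=> j _; rewrite opprK -mulrDr mulr_ge0 ?(ltW (weight_gt0 j))//.
  by rewrite -lerBlDr sub0r.
have lpm : lower_partial_moment Y xi = q i * xi - integrated_quantile F (q i).
  by move: pinball_min; lra.
apply/le_anti; rewrite (left_quantile_le_argmin (X := Y) mP (q01 i) lpm) andbT.
by rewrite uq (le_right_quantile_argmin (X := Y) mP (q01 i) lpm).
Qed.

Let integrable_pinball (a b : R) :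
  P.-integrable setT (EFin \o (fun y => Num.max (a - Y y) 0 - b)).
Proof.
exact: (integrableB measurableT (integrable_lower_partial_moment mP a)
  (finite_measure_integrable_cst P b measurableT)).
Qed.

Let integrable_summand (x : 'rV[R]_n.+1) i : P.-integrable setT
  (EFin \o (fun y => let xi := x ord0 (lift ord_max i) in
    w i * (Num.max (xi - Y y) 0 - q i * xi))).
Proof.
exact: (integrableZl measurableT (w i) (integrable_pinball _ _)).
Qed.

Let quantile_scoreE (x : 'rV[R]_n.+1) y : quantile_score q p x (sub_val y) =
  \sum_(i < n) let xi := x ord0 (lift ord_max i) in
    w i * (Num.max (xi - Y y) 0 - q i * xi).
Proof. by apply: eq_bigr => i _; rewrite /= pinballE. Qed.

Lemma integrable_quantile_score x :
  P.-integrable setT (fun y => (quantile_score q p x (sub_val y))%:E).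
Proof.
under eq_fun do rewrite quantile_scoreE -sumEFin.
by apply: integrable_sum => // i _; exact: integrable_summand.
Qed.

Lemma Rintegral_quantile_score x :
  \int[P]_y quantile_score q p x (sub_val y) = mean_quantile_score x.
Proof.
under eq_Rintegral do rewrite quantile_scoreE.
rewrite Rintegral_sum//; apply: eq_bigr => i _.
rewrite (RintegralZl _ measurableT (integrable_pinball _ _)); congr (_ * _).
rewrite (RintegralB (f2 := cst (q i * x ord0 (lift ord_max i))))//.
  by rewrite Rintegral_cst// [X in fine X]probability_setT mulr1.
  exact: integrable_lower_partial_moment.
exact: (finite_measure_integrable_cst _ _).
Qed.

Variables (c : R) (f f' : R -> R).

(** The score is affine in [quantile_score], with the coefficient [f' xk + c] whose sign the
    condition on [c] controls. *)
Let spectral_scoreE (x : 'rV[R]_n.+1) y : let xk := x ord0 ord_max in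
  spectral_score q p c f f' x y =
  (f' xk * xk - f xk) + (f' xk + c) * quantile_score q p x y.
Proof. by rewrite /spectral_score/=; ring. Qed.

Let integrableZ_quantile_score (a : R) (x : 'rV[R]_n.+1) :
  P.-integrable setT (EFin \o (fun y => a * quantile_score q p x (sub_val y))).
Proof. exact: (integrableZl measurableT a (integrable_quantile_score x)). Qed.

Lemma integrable_spectral_score (x : 'rV[R]_n.+1) : P.-integrable setT
  (EFin \o (fun y => spectral_score q p c f f' x (sub_val y))).
Proof.
apply: eq_integrable (integrableD measurableT
  (finite_measure_integrable_cst P _ measurableT)
  (integrableZ_quantile_score _ x)) => // y _.
by rewrite /= spectral_scoreE.
Qed.

Lemma expected_spectral_score (x : 'rV[R]_n.+1) : let xk := x ord0 ord_max in
  expected_score (fun x y => spectral_score q p c f f' x (sub_val y)) x P =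
  (f' xk * xk - f xk) + (f' xk + c) * mean_quantile_score x.
Proof.
rewrite /expected_score/=; under eq_Rintegral do rewrite spectral_scoreE.
rewrite (RintegralD (f1 := cst _))//; last first.
  exact: (finite_measure_integrable_cst _ _).
rewrite Rintegral_cst// [X in fine X]probability_setT mulr1.
rewrite RintegralZl ?Rintegral_quantile_score//.
exact: integrable_quantile_score.
Qed.

End spectral.

(** * Consistency and strict consistency over the class of laws *)

Section consistency.
Context {R : realType} {O : set R} {O0 : O !=set0} {n : nat}.
Variable FF : set (probability (borel_sub O0) R).
Hypothesis FF_moment : forall P, FF P -> finite_first_moment P.
Variables q p : 'I_n -> R.
Hypotheses (q01 : forall i, 0 < q i < 1) (p01 : forall i, 0 < p i <= 1).

Local Notation T := (quantiles_and_neg_risk (O0 := O0) q p).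
Local Notation A := (image_product FF T).
Local Notation Tk := (neg_spectral_risk (O0 := O0) q p @` FF).

Variables (c : R) (f f' : R -> R).

Local Notation S := (fun (x : 'rV[R]_n.+1) (y : borel_sub O0) =>
  spectral_score q p c f f' x (sub_val y)).

Let image_product_max x : A x -> Tk (x ord0 ord_max).
Proof.
by move=> /(_ ord_max)[P FP <-]; exists P; rewrite ?quantiles_and_neg_risk_max.
Qed.

Let expected_score_quantiles P : FF P ->
  expected_score S (T P) P =
  - f (neg_spectral_risk q p P) - c * neg_spectral_risk q p P.
Proof.
move=> FP; rewrite expected_spectral_score//; last exact: FF_moment.
rewrite mean_quantile_score_quantiles//; last exact: FF_moment.
by rewrite quantiles_and_neg_risk_max; ring.
Qed.

(** With [s] the last entry of [x], [t] the value of [neg_spectral_risk] at [P] and [m] the mean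
    quantile score of [x], the excess score is [(f t - f s - f' s * (t - s)) + (f' s + c) * (m +
    t)], a sum of two nonnegative terms. *)
Lemma spectral_score_consistent :
  (forall s t, Tk s -> Tk t -> f s + f' s * (t - s) <= f t) ->
  (forall t, Tk t -> - f' t <= c) ->
  consistent A FF T S.
Proof.
move=> f_tangent f'c; split=> [x Ax P FP|x P Ax FP].
  by apply: integrable_spectral_score; exact: FF_moment.
have Tkx := image_product_max Ax; have mP := FF_moment FP.
rewrite expected_score_quantiles// expected_spectral_score//.
have TkP : Tk (neg_spectral_risk q p P) by exists P.
have := le_mean_quantile_score q01 p01 mP x.
have := f_tangent _ _ Tkx TkP; have := f'c _ Tkx.
nra.
Qed.

(** Both terms of the excess must vanish. The first forces [s = t] by the strict tangent inequality;
    the second, having a positive coefficient, forces [m = - t], which determines the quantiles. *)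
Lemma spectral_score_strictly_consistent :
  (forall P, FF P ->
    forall i, unique_quantile (distribution_function P) (q i)) ->
  (forall s t, Tk s -> Tk t -> s != t -> f s + f' s * (t - s) < f t) ->
  (forall t, Tk t -> - f' t < c) ->
  strictly_consistent A FF T S.
Proof.
move=> uq f_tangent f'c; split.
  apply: spectral_score_consistent => [s t Tks Tkt|t Tkt].
    have [->|st] := eqVneq s t; first by rewrite subrr mulr0 addr0.
    by rewrite ltW// f_tangent.
  by rewrite ltW// f'c.
move=> x P Ax FP.
have Tkx := image_product_max Ax; have mP := FF_moment FP.
rewrite expected_score_quantiles// expected_spectral_score//.
have TkP : Tk (neg_spectral_risk q p P) by exists P.
have lex := le_mean_quantile_score q01 p01 mP x; have f'cx := f'c _ Tkx.
move=> scoreE.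
have xk : x ord0 ord_max = neg_spectral_risk q p P.
  apply/eqP; rewrite -[_ == _]negbK; apply/negP => /(f_tangent _ _ Tkx TkP).
  nra.
have meanE : mean_quantile_score q p P x = - neg_spectral_risk q p P.
  have : f' (x ord0 ord_max) + c != 0 by rewrite gt_eqF//; lra.
  move=> /mulfI; apply.
  by rewrite xk in scoreE *; lra.
apply/rowP => j; case: (unliftP ord_max j) => [i ->|->].
  rewrite quantiles_and_neg_risk_lift.
  exact: (mean_quantile_score_min_unique q01 p01 mP (uq P FP) meanE).
by rewrite quantiles_and_neg_risk_max.
Qed.

End consistency.

Theorem corollary4p18 (R : realType) (O : set R) (O0 : O !=set0)
    (FF : set (probability (borel_sub O0) R))
    (FF_moment : forall P, FF P -> finite_first_moment P)
    (n : nat) (n_ge1 : (1 <= n)%N)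
    (q p : 'I_n -> R)
    (q01 : forall i, 0 < q i < 1)
    (q_distinct : injective q)
    (p01 : forall i, 0 < p i <= 1)
    (p_sum : \sum_(i < n) p i = 1) :
  let T := quantiles_and_neg_risk (O0 := O0) q p in
  let A := image_product FF T in
  let Tk := neg_spectral_risk (O0 := O0) q p @` FF in
  let uniq_quantiles :=
    forall P, FF P -> forall i, unique_quantile (distribution_function P) (q i) in
  (uniq_quantiles -> elicitable A FF T) /\
  forall (c : R) (f f' : R -> R),
    (* the interval hull of Tk is Tk itself when Tk is an interval *)
    convex_function (E := R^o) [set` Rhull Tk] f ->
    (forall t, Tk t -> is_derive_within [set` Rhull Tk] f t (f' t)) ->
    (forall t, Tk t -> - f' t <= c) ->
    let S := fun x (y : borel_sub O0) => spectral_score q p c f f' x (sub_val y) in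
    consistent A FF T S /\
    (uniq_quantiles ->
     strictly_convex_function [set` Rhull Tk] f ->
     (forall t, Tk t -> - f' t < c) ->
     strictly_consistent A FF T S).
Proof.
move=> T A Tk uniq_quantiles; split=> [uq|c f f' cf df f'c S].
  exists (fun x y => spectral_score q p 0 expR expR x (sub_val y)).
  apply: spectral_score_strictly_consistent => // [s t _ _ st|t _].
    (* The strict tangent inequality of exp at [s] is [1 + (t - s) < expR (t - s)] multiplied by
       [expR s]. *)
    have /expR_gt1Dx : t - s != 0 by rewrite subr_eq0 eq_sym.
    rewrite -(ltr_pM2l (expR_gt0 s)) -expRD mulrDr mulr1.
    by rewrite [s + _]addrC subrK.
  by rewrite oppr_lt0 expR_gt0.
have hull := @sub_Rhull R Tk.
split=> [|uq scf f'c_lt].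
  apply: spectral_score_consistent => // s t Tks Tkt.
  by apply: (convex_tangent_le cf) (df _ Tks); exact: hull.
apply: spectral_score_strictly_consistent => // s t Tks Tkt st.
by apply: (strictly_convex_tangent_lt cf scf) (df _ Tks) => //; exact: hull.
Qed.
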